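(* Let $(\lambda_0,\lambda_1,\lambda_2,\lambda_3)\in\mathbb{C}^4$. Then the function $\rho$ is odd if and only if $\lambda_0+\lambda_1=\lambda_2+\lambda_3$.
   Context: For $(\mu_0,\dots,\mu_N)\in\mathbb{C}^{N+1}$ let $\Phi_{(\mu_0,\dots,\mu_N)}$ (the fundamental function) be the unique solution of $\prod_{j=0}^N(\frac{d}{dx}-\mu_j)\Phi=0$ on $\mathbb{R}$ with $\Phi^{(k)}(0)=0$ for $k=0,\dots,N-1$ and $\Phi^{(N)}(0)=1$. On the set of real $x$ where the denominator does not vanish (a set symmetric about $0$) define $$\rho(x)=\frac{\Phi'_{(\lambda_0,\dots,\lambda_3)}(x)\Phi_{(\lambda_0,\lambda_1)}(x)-\Phi_{(\lambda_0,\dots,\lambda_3)}(x)\Phi'_{(\lambda_0,\lambda_1)}(x)}{\Phi_{(\lambda_0,\lambda_1)}(x)\Phi_{(\lambda_2,\lambda_3)}(x)}.$$ *)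

(* Defs.v *)
(* Stdlib reals, with Coquelicot's complex numbers and derivatives. *)
From Stdlib Require Import Reals List ClassicalEpsilon.
From Coquelicot Require Import Coquelicot.
Import ListNotations.

Open Scope R_scope.
Open Scope C_scope.

(* Derivative of a complex-valued function of a real variable. It is a total
   operator, like [Derive], and it is meaningful where [f] is differentiable. *)
Definition CDerive (f : R -> C) (x : R) : C :=
  (Derive (fun t => Re (f t)) x, Derive (fun t => Im (f t)) x).

Fixpoint CDerive_n (k : nat) (f : R -> C) : R -> C :=
  match k with
  | O => f
  | S k' => CDerive (CDerive_n k' f)
  end.

Definition differentiable_n (n : nat) (f : R -> C) : Prop :=
  forall (k : nat) (x : R), (k < n)%nat ->
    ex_derive (K := R_AbsRing) (V := C_R_NormedModule) (CDerive_n k f) x.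

Definition shifted_derive (mu : C) (f : R -> C) : R -> C :=
  fun x => CDerive f x - mu * f x.

(* The product of the operators d/dx - mu over the list is their composition. *)
Definition diff_op (mus : list C) (f : R -> C) : R -> C :=
  fold_right shifted_derive f mus.

(* The nonempty list [mus] is (mu_0, ..., mu_N), so that N + 1 is its length. *)
Definition is_fundamental (mus : list C) (phi : R -> C) : Prop :=
  let N := pred (length mus) in
  differentiable_n (S N) phi /\
  (forall x : R, diff_op mus phi x = 0) /\
  (forall k : nat, (k < N)%nat -> CDerive_n k phi 0%R = 0) /\
  CDerive_n N phi 0%R = 1.

(* For a nonempty list, exactly one function satisfies [is_fundamental mus];
   [epsilon] selects it. *)
Definition Phi (mus : list C) : R -> C :=
  @epsilon (R -> C) (inhabits (fun _ : R => RtoC 0)) (is_fundamental mus).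

Definition rho_denominator (l0 l1 l2 l3 : C) (x : R) : C :=
  Phi [l0; l1] x * Phi [l2; l3] x.

Definition rho_domain (l0 l1 l2 l3 : C) (x : R) : Prop :=
  rho_denominator l0 l1 l2 l3 x <> 0.

(* Meaningful only on [rho_domain l0 l1 l2 l3]. *)
Definition rho (l0 l1 l2 l3 : C) (x : R) : C :=
  (CDerive (Phi [l0; l1; l2; l3]) x * Phi [l0; l1] x
   - Phi [l0; l1; l2; l3] x * CDerive (Phi [l0; l1]) x)
  / rho_denominator l0 l1 l2 l3 x.

(* An odd function on [D]; as usual, its domain must be symmetric about 0. *)
Definition odd_on (D : R -> Prop) (f : R -> C) : Prop :=
  (forall x : R, D x -> D (- x)%R) /\
  (forall x : R, D x -> f (- x)%R = - f x).

(* Main.v *)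
Require Import Defs.
From Stdlib Require Import Reals List ClassicalEpsilon Lra Lia Permutation FunctionalExtensionality.
From Coquelicot Require Import Coquelicot.
Import ListNotations.

Open Scope R_scope.
Open Scope C_scope.

(** Write P = Phi[l0; l1], Q = Phi[l2; l3], F = Phi[l0; l1; l2; l3], W = F' P - F P' and
    Den = P Q, so that rho = W / Den; put sigma = l0 + l1 and tau = l0 + l1 + l2 + l3.

    If l0 + l1 = l2 + l3 = s, then each of the multisets {l0, l1}, {l2, l3}, {l0, l1, l2, l3}
    is mapped to itself by m |-> s - m.  For an exponent list of length N + 1 with this
    symmetry, x |-> (-1)^N e^(s x) Phi(-x) solves the same initial value problem as Phi, because
    (d/dx - m) (e^(s x) g(-x)) = - e^(s x) ((d/dx - (s - m)) g)(-x); by uniqueness it is Phi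
    ([Phi_reflect]).  So P, Q and F all satisfy f(x) = - e^(s x) f(-x), which gives
    W(x) = - e^(2 s x) W(-x) and Den(x) = e^(2 s x) Den(-x), and rho is odd ([rho_opp]).

    Conversely, oddness of rho on a symmetric domain says W(-x) Den(x) + W(x) Den(-x) = 0 for
    every x, including the zeros of Den.  The differential equation gives
    Phi^(N+1)(0) = mu_0 + ... + mu_N, hence two terms of the expansion of each factor at 0
    (the predicate [has_expansion]):
      W   = x^3 / 3 + (sigma / 12 + tau / 8) x^4 + o(x^4),
      Den = x^2 + (tau / 2) x^3 + o(x^3).
    In the identity the x^5 terms cancel, and the coefficient of x^6 is
    2 (sigma / 12 + tau / 8 - tau / 6) = (l0 + l1 - l2 - l3) / 12, which must therefore be 0
    ([odd_rho_sums_equal]).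

    Both parts rest on existence and uniqueness for the initial value problem, obtained by
    solving one first-order equation y' = m y + h at a time ([fundamental_exists],
    [initial_value_unique]); existence is what makes the chosen function [Phi mus] a fundamental
    function. *)

(** * Derivatives of complex-valued functions of a real variable *)

Definition has_deriv (f : R -> C) (x : R) (l : C) : Prop :=
  is_derive (K := R_AbsRing) (V := C_R_NormedModule) f x l.

Lemma has_deriv_components f x l :
  has_deriv f x l <->
  is_derive (fun t => Re (f t)) x (Re l) /\ is_derive (fun t => Im (f t)) x (Im l).
Proof.
  unfold has_deriv, is_derive. split.
  - intros H. split.
    + eapply filterdiff_ext_lin.
      * refine (filterdiff_comp (V := C_R_NormedModule) f _ _ (fun z : C => Re z) H _).
        apply filterdiff_linear, is_linear_fst.
      * intros y. reflexivity.
    + eapply filterdiff_ext_lin.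
      * refine (filterdiff_comp (V := C_R_NormedModule) f _ _ (fun z : C => Im z) H _).
        apply filterdiff_linear, is_linear_snd.
      * intros y. reflexivity.
  - intros [H1 H2].
    apply (filterdiff_ext (fun t => (Re (f t), Im (f t)))).
    { intros t. now destruct (f t). }
    eapply filterdiff_ext_lin.
    + refine (filterdiff_comp_2 (W := C_R_NormedModule) _ _ (fun a b : R => (a, b))
                _ _ (fun a b : R => (a, b)) H1 H2 _).
      apply (filterdiff_ext (fun t => t)).
      { intros [u v]; reflexivity. }
      apply (filterdiff_ext_lin _ (fun t => t)).
      { apply filterdiff_id. }
      { intros [u v]; reflexivity. }
    + intros y. reflexivity.
Qed.

Lemma has_deriv_CDerive f x l : has_deriv f x l -> CDerive f x = l.
Proof.
  intros [H1 H2]%has_deriv_components. unfold CDerive.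
  apply injective_projections;
    [exact (is_derive_unique _ _ _ H1)|exact (is_derive_unique _ _ _ H2)].
Qed.

Lemma CDerive_correct f x :
  ex_derive (K := R_AbsRing) (V := C_R_NormedModule) f x -> has_deriv f x (CDerive f x).
Proof.
  intros [l H]. now rewrite (has_deriv_CDerive f x l H).
Qed.

Lemma has_deriv_eq f x l l' : has_deriv f x l -> l = l' -> has_deriv f x l'.
Proof. now intros H <-. Qed.

Lemma has_deriv_const c x : has_deriv (fun _ => c) x 0.
Proof. apply @is_derive_const. Qed.

Lemma has_deriv_plus f g x a b :
  has_deriv f x a -> has_deriv g x b -> has_deriv (fun t => f t + g t) x (a + b).
Proof. apply @is_derive_plus. Qed.

Lemma has_deriv_mult f g x a b :
  has_deriv f x a -> has_deriv g x b ->
  has_deriv (fun t => f t * g t) x (a * g x + f x * b).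
Proof.
  intros [F1 F2]%has_deriv_components [G1 G2]%has_deriv_components.
  apply has_deriv_components; split.
  - evar_last.
    + apply @is_derive_minus; apply @is_derive_mult;
      [exact F1|exact G1|apply Rmult_comm|exact F2|exact G2|apply Rmult_comm].
    + unfold minus, plus, opp, mult, Re, Im; simpl; ring.
  - evar_last.
    + apply @is_derive_plus; apply @is_derive_mult;
      [exact F1|exact G2|apply Rmult_comm|exact F2|exact G1|apply Rmult_comm].
    + unfold minus, plus, opp, mult, Re, Im; simpl; ring.
Qed.

Lemma has_deriv_scal c f x a : has_deriv f x a -> has_deriv (fun t => c * f t) x (c * a).
Proof.
  intros H. eapply has_deriv_eq.
  - apply (has_deriv_mult (fun _ => c)); [apply has_deriv_const|exact H].
  - ring.
Qed.

Lemma has_deriv_flip g x l :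
  has_deriv g (- x)%R l -> has_deriv (fun t => g (- t)%R) x (- l).
Proof.
  intros H.
  assert (O : is_derive (fun t : R => (- t)%R) x (-1)%R) by (auto_derive; [trivial|simpl; lra]).
  eapply has_deriv_eq; [exact (is_derive_comp g Ropp x l (-1)%R H O)|].
  apply injective_projections; unfold scal; simpl; unfold scal; simpl; unfold mult; simpl; ring.
Qed.

Lemma zero_deriv_constant f :
  (forall x, has_deriv f x 0) -> forall x, f x = f 0%R.
Proof.
  intros H x. destruct (Rtotal_order x 0) as [L|[->|L]]; [|reflexivity|].
  - refine (eq_is_derive (V := C_R_NormedModule) f x 0 _ L). intros t _. apply H.
  - symmetry. refine (eq_is_derive (V := C_R_NormedModule) f 0 x _ L). intros t _. apply H.
Qed.

(** * First-order linear equations *)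

(** The function x |-> e^(m x), for complex m. *)
Definition cexp (m : C) (x : R) : C :=
  (exp (Re m * x) * cos (Im m * x), exp (Re m * x) * sin (Im m * x))%R.

Lemma has_deriv_cexp m x : has_deriv (cexp m) x (m * cexp m x).
Proof.
  apply has_deriv_components; split; unfold cexp, Re, Im; simpl;
    auto_derive; trivial; ring.
Qed.

Lemma cexp_0 m : cexp m 0 = 1.
Proof.
  unfold cexp. rewrite !Rmult_0_r, exp_0, cos_0, sin_0, Rmult_1_l, Rmult_0_r. reflexivity.
Qed.

Lemma cexp_opp m x : cexp m x * cexp (- m) x = 1.
Proof.
  unfold cexp. replace (Re (- m) * x)%R with (- (Re m * x))%R by (simpl; unfold Re; ring).
  replace (Im (- m) * x)%R with (- (Im m * x))%R by (simpl; unfold Im; ring).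
  rewrite cos_neg, sin_neg, exp_Ropp.
  pose proof (exp_pos (Re m * x)). pose proof (sin2_cos2 (Im m * x)) as S. unfold Rsqr in S.
  apply injective_projections; simpl; field_simplify; try lra.
Qed.

Lemma cexp_neq0 m x : cexp m x <> 0.
Proof.
  intros H. pose proof (cexp_opp m x) as K. rewrite H, Cmult_0_l in K.
  now apply C1_nz.
Qed.

(** The product e^(-m x) f(x) has derivative zero. *)
Lemma first_order_unique m f :
  (forall x, has_deriv f x (m * f x)) -> f 0%R = 0 -> forall x, f x = 0.
Proof.
  intros H H0 x.
  assert (K : cexp (- m) x * f x = cexp (- m) 0 * f 0%R).
  { apply (zero_deriv_constant (fun t => cexp (- m) t * f t)). intros t. eapply has_deriv_eq.
    - apply has_deriv_mult; [apply has_deriv_cexp|apply H].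
    - ring. }
  rewrite H0, Cmult_0_r in K.
  destruct (Ceq_dec (f x) 0) as [E|E]; [exact E|].
  now destruct (Cmult_neq_0 _ _ (cexp_neq0 (- m) x) E).
Qed.

(** Variation of constants. *)
Lemma first_order_exists m c h :
  (forall x, ex_derive (K := R_AbsRing) (V := C_R_NormedModule) h x) ->
  exists f, f 0%R = c /\ forall x, has_deriv f x (m * f x + h x).
Proof.
  intros H.
  set (k := fun t => cexp (- m) t * h t).
  assert (Hk : forall t, continuous (U := C_R_NormedModule) k t).
  { intros t. apply @ex_derive_continuous. eexists.
    apply has_deriv_mult; [apply has_deriv_cexp|apply CDerive_correct, H]. }
  set (J := fun x => RInt (V := C_R_CompleteNormedModule) k 0 x).
  assert (HJ : forall x, has_deriv J x (k x)).
  { intros x. apply (is_derive_RInt (V := C_R_NormedModule) k J 0); [|apply Hk].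
    apply filter_forall. intros y. unfold J.
    apply (RInt_correct (V := C_R_CompleteNormedModule)).
    apply (ex_RInt_continuous (V := C_R_CompleteNormedModule)). intros z _. apply Hk. }
  exists (fun x => cexp m x * (c + J x)). split.
  - unfold J. rewrite (RInt_point (V := C_R_CompleteNormedModule)), cexp_0.
    change (@zero C_R_CompleteNormedModule) with (RtoC 0). ring.
  - intros x. eapply has_deriv_eq.
    + apply has_deriv_mult; [apply has_deriv_cexp|].
      apply has_deriv_plus; [apply has_deriv_const|apply HJ].
    + unfold k. rewrite <- (Cmult_1_l (h x)) at 2. rewrite <- (cexp_opp m x). ring.
Qed.

(** * Iterated derivatives and the operators *)

Lemma CDerive_n_shift k f : CDerive_n (S k) f = CDerive_n k (CDerive f).
Proof.
  induction k as [|k IH]; [reflexivity|].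
  change (CDerive (CDerive_n (S k) f) = CDerive (CDerive_n k (CDerive f))). now rewrite IH.
Qed.

Lemma differentiable_n_S n f :
  differentiable_n (S n) f <->
  (forall x, has_deriv f x (CDerive f x)) /\ differentiable_n n (CDerive f).
Proof.
  split.
  - intros H. split.
    + intros x. apply CDerive_correct, (H 0%nat x). lia.
    + intros k x Hk. rewrite <- CDerive_n_shift. apply H. lia.
  - intros [H1 H2] [|k] x Hk.
    + eexists. apply H1.
    + rewrite CDerive_n_shift. apply H2. lia.
Qed.

Lemma differentiable_n_le m n f : (m <= n)%nat -> differentiable_n n f -> differentiable_n m f.
Proof. intros L H k x Hk. apply H. lia. Qed.

Lemma CDerive_lin a b f g :
  (forall x, has_deriv f x (CDerive f x)) -> (forall x, has_deriv g x (CDerive g x)) ->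
  CDerive (fun x => a * f x + b * g x) = fun x => a * CDerive f x + b * CDerive g x.
Proof.
  intros F G. apply functional_extensionality. intros x. apply has_deriv_CDerive.
  apply has_deriv_plus; apply has_deriv_scal; auto.
Qed.

Lemma differentiable_n_lin n : forall a b f g,
  differentiable_n n f -> differentiable_n n g ->
  differentiable_n n (fun x => a * f x + b * g x).
Proof.
  induction n as [|n IH]; intros a b f g F G.
  - intros k x Hk. lia.
  - apply differentiable_n_S in F as [F1 F2]. apply differentiable_n_S in G as [G1 G2].
    apply differentiable_n_S. rewrite CDerive_lin by assumption. split; [|now apply IH].
    intros x. apply has_deriv_plus; apply has_deriv_scal; auto.
Qed.

Lemma CDerive_n_lin k : forall a b f g,
  differentiable_n k f -> differentiable_n k g ->
  CDerive_n k (fun x => a * f x + b * g x) = fun x => a * CDerive_n k f x + b * CDerive_n k g x.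
Proof.
  induction k as [|k IH]; intros a b f g F G; [reflexivity|].
  apply differentiable_n_S in F as [F1 F2]. apply differentiable_n_S in G as [G1 G2].
  rewrite !CDerive_n_shift, CDerive_lin by assumption. now apply IH.
Qed.

Lemma shifted_derive_lin m f :
  shifted_derive m f = fun x => 1 * CDerive f x + (- m) * f x.
Proof. apply functional_extensionality. intros x. unfold shifted_derive. ring. Qed.

Lemma differentiable_n_shifted n m f :
  differentiable_n (S n) f -> differentiable_n n (shifted_derive m f).
Proof.
  intros H. rewrite shifted_derive_lin. apply differentiable_n_lin.
  - now apply differentiable_n_S.
  - now apply (differentiable_n_le n (S n)); [lia|].
Qed.

Lemma CDerive_n_shifted k m f :
  differentiable_n (S k) f ->
  CDerive_n k (shifted_derive m f) = fun x => CDerive_n (S k) f x - m * CDerive_n k f x.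
Proof.
  intros H. rewrite shifted_derive_lin, CDerive_n_lin, CDerive_n_shift.
  - apply functional_extensionality. intros x. ring.
  - now apply differentiable_n_S.
  - now apply (differentiable_n_le k (S k)); [lia|].
Qed.

Lemma diff_op_app mus nus f : diff_op (mus ++ nus) f = diff_op mus (diff_op nus f).
Proof. apply fold_right_app. Qed.

Lemma differentiable_n_diff_op mus : forall n f,
  differentiable_n (length mus + n) f -> differentiable_n n (diff_op mus f).
Proof.
  induction mus as [|m mus IH]; intros n f H; [exact H|].
  apply differentiable_n_shifted, IH. now rewrite Nat.add_succ_r.
Qed.

(** The factors d/dx - m commute, so the operator depends only on the multiset of exponents. *)
Lemma diff_op_perm mus nus f :
  Permutation mus nus -> differentiable_n (length mus) f -> diff_op mus f = diff_op nus f.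
Proof.
  induction 1 as [|m mus nus P IH|a b mus|mus nus xis P1 IH1 P2 IH2]; intros H.
  - reflexivity.
  - change (shifted_derive m (diff_op mus f) = shifted_derive m (diff_op nus f)).
    rewrite IH; [reflexivity|]. simpl in H.
    now apply (differentiable_n_le _ (S (length mus))); [lia|].
  - change (shifted_derive b (shifted_derive a (diff_op mus f)) =
            shifted_derive a (shifted_derive b (diff_op mus f))).
    set (g := diff_op mus f).
    assert (G : differentiable_n 2 g).
    { apply differentiable_n_diff_op. now rewrite Nat.add_comm. }
    apply functional_extensionality. intros x.
    (* Both sides are g'' - (a + b) g' + a b g. *)
    unfold shifted_derive at 1 3.
    change (CDerive (shifted_derive a g)) with (CDerive_n 1 (shifted_derive a g)).
    change (CDerive (shifted_derive b g)) with (CDerive_n 1 (shifted_derive b g)).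
    rewrite !CDerive_n_shifted by assumption. unfold shifted_derive. simpl. ring.
  - rewrite IH1 by assumption. apply IH2. now rewrite <- (Permutation_length P1).
Qed.

(** * Existence and uniqueness of fundamental functions *)

(** The last exponent of the list belongs to the innermost factor.  Peeling it off replaces [f]
    by f' - m f, to which the shorter list applies, and leaves a first-order equation. *)
Lemma initial_value_unique mus : forall f,
  differentiable_n (length mus) f -> (forall x, diff_op mus f x = 0) ->
  (forall k, (k < length mus)%nat -> CDerive_n k f 0%R = 0) -> forall x, f x = 0.
Proof.
  induction mus as [|m mus IH] using rev_ind; intros f D E I.
  - exact E.
  - rewrite length_app, Nat.add_1_r in D, I.
    assert (Z : forall x, shifted_derive m f x = 0).
    { apply IH.
      - now apply differentiable_n_shifted.
      - intros x. rewrite <- (E x), diff_op_app. reflexivity.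
      - intros k Hk. rewrite CDerive_n_shifted
          by (apply (differentiable_n_le _ (S (length mus))); [lia|assumption]).
        rewrite !I by lia. ring. }
    apply (first_order_unique m).
    + intros x. apply differentiable_n_S in D as [D _]. eapply has_deriv_eq; [apply D|].
      specialize (Z x). unfold shifted_derive in Z.
      rewrite <- (Cplus_0_r (m * f x)), <- Z. ring.
    + apply (I 0%nat). lia.
Qed.

Lemma diff_op_lin nus : forall n a b f g,
  differentiable_n (length nus + n) f -> differentiable_n (length nus + n) g ->
  diff_op nus (fun x => a * f x + b * g x) = fun x => a * diff_op nus f x + b * diff_op nus g x.
Proof.
  induction nus as [|m nus IH]; intros n a b f g F G; [reflexivity|].
  change (shifted_derive m (diff_op nus (fun x => a * f x + b * g x)) = fun x =>
    a * shifted_derive m (diff_op nus f) x + b * shifted_derive m (diff_op nus g) x).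
  simpl in F, G. rewrite <- Nat.add_succ_r in F, G.
  rewrite (IH (S n)) by assumption.
  apply functional_extensionality. intros x. unfold shifted_derive at 1.
  apply differentiable_n_diff_op, differentiable_n_S in F as [F _].
  apply differentiable_n_diff_op, differentiable_n_S in G as [G _].
  rewrite CDerive_lin by assumption. unfold shifted_derive. ring.
Qed.

Lemma S_pred_length (mus : list C) : mus <> [] -> S (pred (length mus)) = length mus.
Proof. now destruct mus. Qed.

Lemma fundamental_unique mus f g :
  mus <> [] -> is_fundamental mus f -> is_fundamental mus g -> f = g.
Proof.
  intros NE (Df & Ef & If & Lf) (Dg & Eg & Ig & Lg).
  pose proof (S_pred_length mus NE) as L.
  rewrite L in Df, Dg.
  apply functional_extensionality. intros x.
  assert (Z : 1 * f x + - (1) * g x = 0).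
  { apply (initial_value_unique mus (fun x => 1 * f x + - (1) * g x)).
    - now apply differentiable_n_lin.
    - intros t. rewrite (diff_op_lin mus 0) by (now rewrite Nat.add_0_r).
      rewrite Ef, Eg. ring.
    - intros k Hk.
      rewrite CDerive_n_lin by (apply (differentiable_n_le _ (length mus)); [lia|assumption]).
      destruct (Nat.eq_dec k (pred (length mus))) as [->|NK].
      + rewrite Lf, Lg. ring.
      + rewrite If, Ig by lia. ring. }
  replace (f x) with ((1 * f x + - (1) * g x) + g x) by ring. rewrite Z. ring.
Qed.

(** Appending an exponent [m] to the list turns a fundamental function [h] into the solution of
    f' = m f + h with f(0) = 0: each derivative of [f] at 0 is then the preceding one of [h]
    until the first nonzero value 1.  Smoothness of [h] is carried along because [f] has to
    be one order smoother than the shorter list provides. *)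
Lemma fundamental_exists mus :
  mus <> [] -> exists f, is_fundamental mus f /\ forall n, differentiable_n n f.
Proof.
  assert (Smooth : forall m f h, (forall n, differentiable_n n h) ->
            (forall x, has_deriv f x (m * f x + h x)) -> forall n, differentiable_n n f).
  { intros m f h Hh Hf n. induction n as [|n IH]; [intros k x Hk; lia|].
    assert (E : CDerive f = fun x => m * f x + 1 * h x).
    { apply functional_extensionality. intros x. apply has_deriv_CDerive.
      rewrite Cmult_1_l. apply Hf. }
    apply differentiable_n_S. split.
    - intros x. eapply has_deriv_eq; [apply Hf|]. rewrite E. ring.
    - rewrite E. now apply differentiable_n_lin. }
  induction mus as [|m mus IH] using rev_ind; [easy|]. intros _.
  assert (mus = [] \/ mus <> []) as [->|NE] by (destruct mus; [now left|now right]).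
  - assert (Z : forall n, differentiable_n n (fun _ : R => RtoC 0)).
    { intros n. induction n as [|n IHn]; [intros k x Hk; lia|].
      assert (E : CDerive (fun _ : R => RtoC 0) = fun _ => RtoC 0).
      { apply functional_extensionality. intros x. apply has_deriv_CDerive, has_deriv_const. }
      apply differentiable_n_S. rewrite E. split; [intros x; apply has_deriv_const|exact IHn]. }
    destruct (first_order_exists m 1 (fun _ => RtoC 0)) as (f & f0 & Hf).
    { intros x. apply (Z 1%nat 0%nat x). lia. }
    exists f. pose proof (Smooth m f _ Z Hf) as D. split; [|exact D].
    split; [apply D|]. split; [|split].
    + intros x. change (CDerive f x - m * f x = 0). rewrite (has_deriv_CDerive _ _ _ (Hf x)). ring.
    + simpl. intros k Hk. lia.
    + exact f0.
  - destruct (IH NE) as (h & (_ & Eh & Ih & Lh) & Dh).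
    destruct (first_order_exists m 0 h) as (f & f0 & Hf).
    { intros x. apply (Dh 1%nat 0%nat x). lia. }
    exists f. pose proof (Smooth m f _ Dh Hf) as D. split; [|exact D].
    pose proof (S_pred_length mus NE) as L.
    assert (E : CDerive f = fun x => m * f x + 1 * h x).
    { apply functional_extensionality. intros x. apply has_deriv_CDerive.
      rewrite Cmult_1_l. apply Hf. }
    assert (I : forall k, (k < length mus)%nat -> CDerive_n k f 0%R = 0).
    { induction k as [|k IHk]; intros Hk; [exact f0|].
      rewrite CDerive_n_shift, E, CDerive_n_lin by auto. rewrite IHk, Ih by lia. ring. }
    split; [apply D|]. rewrite length_app, Nat.add_1_r. simpl pred.
    split; [|split; [exact I|]].
    + intros x. rewrite diff_op_app.
      replace (diff_op [m] f) with h; [apply Eh|].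
      apply functional_extensionality. intros t.
      change (h t = CDerive f t - m * f t). rewrite E. ring.
    + rewrite <- L, CDerive_n_shift, E, CDerive_n_lin by auto.
      rewrite I, Lh by lia. ring.
Qed.

Lemma Phi_fundamental mus : mus <> [] -> is_fundamental mus (Phi mus).
Proof.
  intros NE. unfold Phi. apply epsilon_spec.
  destruct (fundamental_exists mus NE) as (f & H & _). now exists f.
Qed.

(** * Derivatives at 0 *)

(** Expanding the operator, all terms but the leading one are derivatives of order less
    than [N], which vanish at 0. *)
Lemma CDerive_n_diff_op_initial N g :
  differentiable_n N g -> (forall j, (j < N)%nat -> CDerive_n j g 0%R = 0) ->
  forall nus j, (j + length nus <= N)%nat ->
  CDerive_n j (diff_op nus g) 0%R = CDerive_n (j + length nus) g 0%R.
Proof.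
  intros D I nus. induction nus as [|m nus IH]; intros j Hj; simpl in Hj.
  - now rewrite Nat.add_0_r.
  - change (diff_op (m :: nus) g) with (shifted_derive m (diff_op nus g)).
    rewrite CDerive_n_shifted.
    + rewrite !IH by lia. rewrite (I (j + length nus)%nat) by lia.
      replace (j + length (m :: nus))%nat with (S j + length nus)%nat by (simpl; lia). ring.
    + apply differentiable_n_diff_op, (differentiable_n_le _ N); [lia|assumption].
Qed.

(** With Phi^(k)(0) = 0 for k < N, only the two leading terms of the operator,
    Phi^(N+1) - (mu_0 + ... + mu_N) Phi^(N), survive at 0. *)
Lemma fundamental_next_derivative mus g :
  mus <> [] -> is_fundamental mus g ->
  CDerive_n (length mus) g 0%R = fold_right Cplus 0 mus.
Proof.
  intros NE (D & E & I & L1).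
  pose proof (S_pred_length mus NE) as L.
  set (N := pred (length mus)) in *.
  assert (K : forall nus j, (j + length nus = S N)%nat ->
    CDerive_n j (diff_op nus g) 0%R = CDerive_n (S N) g 0%R - fold_right Cplus 0 nus).
  { induction nus as [|m nus IH]; intros j Hj; simpl in Hj.
    - rewrite Nat.add_0_r in Hj. subst j. change (diff_op [] g) with g.
      change (fold_right Cplus 0 []) with (RtoC 0). ring.
    - change (diff_op (m :: nus) g) with (shifted_derive m (diff_op nus g)).
      change (fold_right Cplus 0 (m :: nus)) with (m + fold_right Cplus 0 nus).
      rewrite CDerive_n_shifted.
      + rewrite IH by (simpl; lia).
        rewrite (CDerive_n_diff_op_initial N);
          [|apply (differentiable_n_le _ (S N)); [lia|exact D]|exact I|lia].
        replace (j + length nus)%nat with N by lia. rewrite L1. ring.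
      + apply differentiable_n_diff_op, (differentiable_n_le _ (S N)); [lia|assumption]. }
  specialize (K mus 0%nat (eq_sym L)). simpl CDerive_n in K at 1. rewrite E in K.
  rewrite <- L.
  replace (CDerive_n (S N) g 0%R)
    with (CDerive_n (S N) g 0%R - fold_right Cplus 0 mus + fold_right Cplus 0 mus) by ring.
  rewrite <- K. ring.
Qed.

(** * The reflection m |-> s - m of the exponents *)

(** The constant [c] records the sign: each factor d/dx - m changes it. *)
Definition reflect (c s : C) (g : R -> C) (x : R) : C := c * (cexp s x * g (- x)%R).

Lemma has_deriv_reflect c s g :
  (forall x, has_deriv g x (CDerive g x)) ->
  forall x, has_deriv (reflect c s g) x (reflect (- c) s (shifted_derive s g) x).
Proof.
  intros H x. eapply has_deriv_eq.
  - apply has_deriv_scal, has_deriv_mult; [apply has_deriv_cexp|apply has_deriv_flip, H].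
  - unfold reflect, shifted_derive. ring.
Qed.

Lemma differentiable_n_reflect n : forall c s g,
  differentiable_n n g -> differentiable_n n (reflect c s g).
Proof.
  induction n as [|n IH]; intros c s g H; [intros k x Hk; lia|].
  pose proof (proj1 (proj1 (differentiable_n_S _ _) H)) as D.
  assert (E : CDerive (reflect c s g) = reflect (- c) s (shifted_derive s g)).
  { apply functional_extensionality. intros x. now apply has_deriv_CDerive, has_deriv_reflect. }
  apply differentiable_n_S. rewrite E. split.
  - now apply has_deriv_reflect.
  - now apply IH, differentiable_n_shifted.
Qed.

Lemma diff_op_reflect nus : forall c s g,
  differentiable_n (length nus) g ->
  diff_op nus (reflect c s g) =
  reflect ((- (1)) ^ length nus * c) s (diff_op (map (fun m => s - m) nus) g).
Proof.
  induction nus as [|m nus IH]; intros c s g H.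
  - simpl. now rewrite Cmult_1_l.
  - change (diff_op (m :: nus) (reflect c s g))
      with (shifted_derive m (diff_op nus (reflect c s g))).
    simpl in H. rewrite IH by (apply (differentiable_n_le _ (S (length nus))); [lia|exact H]).
    assert (D : differentiable_n 1 (diff_op (map (fun m => s - m) nus) g)).
    { apply differentiable_n_diff_op. now rewrite length_map, Nat.add_1_r. }
    apply differentiable_n_S in D as [D _].
    apply functional_extensionality. intros x. unfold shifted_derive at 1.
    rewrite (has_deriv_CDerive _ _ _ (has_deriv_reflect _ _ _ D x)).
    unfold reflect. change (diff_op (map (fun m => s - m) (m :: nus)) g)
      with (shifted_derive (s - m) (diff_op (map (fun m => s - m) nus) g)).
    unfold shifted_derive. simpl. ring.
Qed.

(** Derivatives are the case of zero exponents, so that [diff_op_reflect] applies to them. *)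
Lemma CDerive_n_diff_op k f : CDerive_n k f = diff_op (repeat (RtoC 0) k) f.
Proof.
  induction k as [|k IH]; [reflexivity|].
  change (CDerive (CDerive_n k f) = shifted_derive 0 (diff_op (repeat (RtoC 0) k) f)).
  rewrite <- IH. apply functional_extensionality. intros x. unfold shifted_derive. ring.
Qed.

Lemma Cpow_sign_square n : (- (1)) ^ n * (- (1)) ^ n = 1.
Proof.
  rewrite <- Cpow_mult_l. replace (- (1) * - (1)) with (RtoC 1) by ring. apply Cpow_1_l.
Qed.

(** The reflected function solves the same equation by the symmetry of the exponents.  Its k-th
    derivative at 0 is (-1)^(N + k) (d/dx - s)^k Phi (0), which for k <= N is
    (-1)^(N + k) Phi^(k)(0). *)
Lemma Phi_reflect mus s :
  mus <> [] -> Permutation mus (map (fun m => s - m) mus) ->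
  Phi mus = reflect ((- (1)) ^ pred (length mus)) s (Phi mus).
Proof.
  intros NE P. pose proof (Phi_fundamental mus NE) as H.
  apply (fundamental_unique mus); [exact NE|exact H|].
  destruct H as (D & E & I & L1).
  pose proof (S_pred_length mus NE) as L.
  set (N := pred (length mus)) in *. set (c := (- (1)) ^ N).
  assert (K : forall k, (k <= N)%nat ->
    CDerive_n k (reflect c s (Phi mus)) 0%R = (- (1)) ^ k * c * CDerive_n k (Phi mus) 0%R).
  { intros k Hk. rewrite CDerive_n_diff_op, diff_op_reflect
      by (rewrite repeat_length; apply (differentiable_n_le _ (S N)); [lia|exact D]).
    unfold reflect. rewrite Ropp_0, cexp_0, repeat_length, Cmult_1_l. f_equal.
    etransitivity; [apply (CDerive_n_diff_op_initial N (Phi mus)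
      (differentiable_n_le N (S N) _ (le_S _ _ (le_n N)) D) I _ 0)|];
      rewrite length_map, repeat_length; [exact Hk|reflexivity]. }
  split; [now apply differentiable_n_reflect|]. split; [|split].
  - intros x. rewrite diff_op_reflect by (now rewrite <- L).
    rewrite <- (diff_op_perm _ _ _ P) by (now rewrite <- L).
    unfold reflect. rewrite E. ring.
  - intros k Hk. fold N in Hk. rewrite K by lia. rewrite I by exact Hk. ring.
  - fold N. rewrite K by lia. rewrite L1. unfold c. rewrite Cpow_sign_square. ring.
Qed.

Lemma Phi_pair_reflect a b : Phi [a; b] = reflect (- (1)) (a + b) (Phi [a; b]).
Proof.
  rewrite (Phi_reflect [a; b] (a + b)) at 1; [|easy|].
  - simpl length. simpl pred. now rewrite Cpow_1_r.
  - simpl. replace (a + b - a) with b by ring. replace (a + b - b) with a by ring.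
    apply perm_swap.
Qed.

Lemma Phi_quadruple_reflect a b c d :
  a + b = c + d -> Phi [a; b; c; d] = reflect (- (1)) (a + b) (Phi [a; b; c; d]).
Proof.
  intros S. rewrite (Phi_reflect [a; b; c; d] (a + b)) at 1; [|easy|].
  - simpl length. simpl pred. f_equal. rewrite 2!Cpow_S, Cpow_1_r. ring.
  - simpl. replace (a + b - a) with b by ring. replace (a + b - b) with a by ring.
    replace (a + b - c) with d by (rewrite S; ring).
    replace (a + b - d) with c by (rewrite S; ring).
    apply (perm_trans (perm_swap _ _ _)). do 2 apply perm_skip. apply perm_swap.
Qed.

(** * Two-term expansions at 0 *)

(** Integration of an expansion, without continuity of the derivative: the mean value theorem
    applied to [f] minus its two expected terms bounds the remainder by |x| times the
    remainder of [df]. *)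
Lemma real_primitive_expansion n (f df g : R -> R) (b : R) :
  (forall x, is_derive f x (df x)) -> f 0%R = 0%R ->
  is_derive g 0%R b -> (forall x, df x = x ^ n * g x)%R ->
  exists h : R -> R, is_derive h 0%R (b * / INR (n + 2))%R /\
    h 0%R = (g 0 * / INR (n + 1))%R /\ forall x, f x = (x ^ (n + 1) * h x)%R.
Proof.
  intros Hf f0 Hg E. set (a := g 0%R).
  exists (fun x => if Req_EM_T x 0 then (a * / INR (n + 1))%R else (f x / x ^ (n + 1))%R).
  split; [|split].
  - apply is_derive_Reals. apply is_derive_Reals in Hg. intros eps Heps.
    (* The final estimate must be strict, hence eps / 2. *)
    destruct (Hg (eps / 2)%R ltac:(lra)) as [d Hd]. exists d. intros x Hx Hxd.
    destruct (Req_EM_T (0 + x) 0) as [C|_]; [lra|].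
    destruct (Req_EM_T 0 0) as [_|C]; [|lra]. rewrite Rplus_0_l.
    set (H := fun t => (f t - (a * / INR (n + 1)) * t ^ (n + 1)
                            - (b * / INR (n + 2)) * t ^ (n + 2))%R).
    set (dH := fun t => (df t - a * t ^ n - b * t ^ (n + 1))%R).
    assert (DH : forall t, is_derive H t (dH t)).
    { intros t. unfold H, dH. rewrite <- (is_derive_unique _ _ _ (Hf t)).
      auto_derive; [eexists; apply Hf|].
      replace (pred (n + 1)) with n by lia. replace (pred (n + 2)) with (n + 1)%nat by lia.
      change (Derive (fun x0 : R => f x0) t) with (Derive f t).
      field. split; apply not_0_INR; lia. }
    destruct (MVT_cor4 H dH 0 (Rabs x) (fun c _ => DH c) x) as (c & Hc & Lc).
    { rewrite Rminus_0_r. lra. }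
    rewrite (Rminus_0_r c), (Rminus_0_r x) in Lc. rewrite (Rminus_0_r x) in Hc.
    assert (H0 : H 0%R = 0%R).
    { unfold H. rewrite f0, !pow_i by lia. ring. }
    rewrite H0, Rminus_0_r in Hc.
    assert (B : (Rabs (g c - a - b * c) <= eps / 2 * Rabs c)%R).
    { destruct (Req_EM_T c 0) as [->|Nc].
      - unfold a. replace (g 0 - g 0 - b * 0)%R with 0%R by ring. rewrite Rabs_R0. lra.
      - assert (Q := Hd c Nc ltac:(lra)). rewrite Rplus_0_l in Q. fold a in Q.
        replace (g c - a - b * c)%R with (((g c - a) / c - b) * c)%R by (field; exact Nc).
        rewrite Rabs_mult. apply Rmult_le_compat_r; [apply Rabs_pos|lra]. }
    assert (Px : (0 < Rabs x)%R) by now apply Rabs_pos_lt.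
    assert (BH : (Rabs (H x) <= eps / 2 * Rabs x ^ (n + 2))%R).
    { rewrite Hc. replace (dH c) with (c ^ n * (g c - a - b * c))%R.
      2:{ unfold dH. rewrite E, Nat.add_1_r. simpl. ring. }
      rewrite !Rabs_mult, <- RPow_abs.
      replace (eps / 2 * Rabs x ^ (n + 2))%R with (Rabs x ^ n * (eps / 2 * Rabs x) * Rabs x)%R
        by (rewrite pow_add; ring).
      apply Rmult_le_compat_r; [lra|]. apply Rmult_le_compat.
      - apply pow_le, Rabs_pos.
      - apply Rabs_pos.
      - apply pow_incr. split; [apply Rabs_pos|exact Lc].
      - apply (Rle_trans _ _ _ B). apply Rmult_le_compat_l; lra. }
    replace ((f x / x ^ (n + 1) - a * / INR (n + 1)) / x - b * / INR (n + 2))%R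
      with (H x / x ^ (n + 2))%R.
    2:{ unfold H. rewrite !pow_add. field.
        repeat split; try (apply not_0_INR; lia); try apply pow_nonzero; exact Hx. }
    unfold Rdiv. rewrite Rabs_mult, Rabs_inv, <- RPow_abs.
    assert (Pn : (0 < Rabs x ^ (n + 2))%R) by now apply pow_lt.
    apply (Rmult_lt_reg_r (Rabs x ^ (n + 2))); [exact Pn|].
    rewrite Rmult_assoc, Rinv_l by lra. nra.
  - destruct (Req_EM_T 0 0) as [_|C]; [reflexivity|lra].
  - intros x. destruct (Req_EM_T x 0) as [->|Nx].
    + rewrite f0, pow_i by lia. ring.
    + field. now apply pow_nonzero.
Qed.

(** The expansion f(x) = a x^n + b x^(n+1) + o(x^(n+1)) at 0, encoded as f(x) = x^n g(x) with
    g(0) = a and g'(0) = b; products of expansions are then governed by the Leibniz rule. *)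
Definition has_expansion (n : nat) (f : R -> C) (a b : C) : Prop :=
  exists g : R -> C, has_deriv g 0%R b /\ g 0%R = a /\ forall x, f x = RtoC (x ^ n)%R * g x.

Lemma has_expansion_eq n f a b a' b' :
  has_expansion n f a b -> a = a' -> b = b' -> has_expansion n f a' b'.
Proof. now intros H <- <-. Qed.

Lemma has_expansion_deriv f b : has_deriv f 0%R b -> has_expansion 0 f (f 0%R) b.
Proof. intros H. exists f. split; [exact H|]. split; [reflexivity|]. intros x. simpl. ring. Qed.

Lemma has_expansion_primitive n f df a b :
  (forall x, has_deriv f x (df x)) -> f 0%R = 0 -> has_expansion n df a b ->
  has_expansion (n + 1) f (a * RtoC (/ INR (n + 1))) (b * RtoC (/ INR (n + 2))).
Proof.
  intros Hf f0 (g & Dg & g0 & E). apply has_deriv_components in Dg as [D1 D2].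
  destruct (real_primitive_expansion n (fun t => Re (f t)) (fun t => Re (df t))
    (fun t => Re (g t)) (Re b)) as (h1 & A1 & B1 & C1).
  - intros x. exact (proj1 (proj1 (has_deriv_components _ _ _) (Hf x))).
  - now rewrite f0.
  - exact D1.
  - intros x. rewrite E. unfold Re; simpl. ring.
  - destruct (real_primitive_expansion n (fun t => Im (f t)) (fun t => Im (df t))
      (fun t => Im (g t)) (Im b)) as (h2 & A2 & B2 & C2).
    + intros x. exact (proj2 (proj1 (has_deriv_components _ _ _) (Hf x))).
    + now rewrite f0.
    + exact D2.
    + intros x. rewrite E. unfold Im; simpl. ring.
    + exists (fun x => (h1 x, h2 x)). split; [|split].
      * apply has_deriv_components. simpl. unfold Re, Im in *. simpl. split.
        -- evar_last; [exact A1|]. simpl. ring.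
        -- evar_last; [exact A2|]. simpl. ring.
      * rewrite B1, B2, g0. apply injective_projections; unfold Re, Im; simpl; ring.
      * intros x. apply injective_projections; simpl.
        -- change (fst (f x)) with (Re (f x)). rewrite C1. ring.
        -- change (snd (f x)) with (Im (f x)). rewrite C2. ring.
Qed.

Lemma has_expansion_plus n f g a b a' b' :
  has_expansion n f a b -> has_expansion n g a' b' ->
  has_expansion n (fun x => f x + g x) (a + a') (b + b').
Proof.
  intros (u & Du & u0 & Eu) (v & Dv & v0 & Ev). exists (fun x => u x + v x).
  split; [now apply has_deriv_plus|]. split; [now rewrite u0, v0|].
  intros x. rewrite Eu, Ev. ring.
Qed.

Lemma has_expansion_mult n m f g a b a' b' :
  has_expansion n f a b -> has_expansion m g a' b' ->
  has_expansion (n + m) (fun x => f x * g x) (a * a') (a * b' + b * a').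
Proof.
  intros (u & Du & u0 & Eu) (v & Dv & v0 & Ev). exists (fun x => u x * v x).
  split; [|split].
  - eapply has_deriv_eq; [apply has_deriv_mult; [exact Du|exact Dv]|]. rewrite u0, v0. ring.
  - now rewrite u0, v0.
  - intros x. rewrite Eu, Ev, pow_add, RtoC_mult. ring.
Qed.

Lemma has_expansion_scal n c f a b :
  has_expansion n f a b -> has_expansion n (fun x => c * f x) (c * a) (c * b).
Proof.
  intros (u & Du & u0 & Eu). exists (fun x => c * u x).
  split; [now apply has_deriv_scal|]. split; [now rewrite u0|].
  intros x. rewrite Eu. ring.
Qed.

Lemma has_expansion_flip n f a b :
  has_expansion n f a b ->
  has_expansion n (fun x => f (- x)%R) (RtoC ((-1) ^ n)%R * a) (- (RtoC ((-1) ^ n)%R * b)).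
Proof.
  intros (u & Du & u0 & Eu). exists (fun x => RtoC ((-1) ^ n)%R * u (- x)%R).
  split; [|split].
  - eapply has_deriv_eq.
    + apply has_deriv_scal, has_deriv_flip. rewrite Ropp_0. exact Du.
    + ring.
  - now rewrite Ropp_0, u0.
  - intros x. rewrite Eu. replace (- x)%R with (-1 * x)%R at 1 by ring.
    rewrite Rpow_mult_distr, RtoC_mult. ring.
Qed.

(** By linearity this is the uniqueness of the two coefficients. *)
Lemma has_expansion_zero n f a b :
  has_expansion n f a b -> (forall x, f x = 0) -> a = 0 /\ b = 0.
Proof.
  intros (g & Dg & g0 & E) Z.
  assert (N : forall x, x <> 0%R -> g x = 0).
  { intros x Hx. destruct (Ceq_dec (g x) 0) as [K|K]; [exact K|].
    destruct (Cmult_neq_0 (RtoC (x ^ n)%R) (g x)); [|exact K|now rewrite <- E].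
    intros Q. apply RtoC_inj in Q. now apply (pow_nonzero x n). }
  (* x g(x) is identically zero, and its derivative at 0 is g(0). *)
  assert (a0 : a = 0).
  { assert (D : has_deriv (fun x => RtoC x * g x) 0%R (1 * g 0%R + RtoC 0 * b)).
    { apply has_deriv_mult; [|exact Dg]. apply has_deriv_components. simpl.
      split; auto_derive; trivial. }
    replace (fun x => RtoC x * g x) with (fun _ : R => RtoC 0) in D.
    - apply has_deriv_CDerive in D.
      rewrite (has_deriv_CDerive _ _ _ (has_deriv_const 0 0%R)) in D.
      rewrite <- g0. transitivity (1 * g 0%R + 0 * b); [ring|]. now rewrite <- D.
    - apply functional_extensionality. intros x.
      destruct (Req_EM_T x 0) as [->|Hx]; [ring|]. rewrite N by exact Hx. ring. }
  split; [exact a0|].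
  replace g with (fun _ : R => RtoC 0) in Dg.
  - rewrite <- (has_deriv_CDerive _ _ _ Dg). now apply has_deriv_CDerive, has_deriv_const.
  - apply functional_extensionality. intros x. symmetry.
    destruct (Req_EM_T x 0) as [->|Hx]; [now rewrite g0|now apply N].
Qed.

(** * Expansions of the fundamental functions *)

Lemma RtoC_inv_INR k : (k <> 0)%nat -> RtoC (/ INR k) = / RtoC (INR k).
Proof. intros H. apply RtoC_inv. now apply not_0_INR. Qed.

Ltac inv_INR_field :=
  rewrite !RtoC_inv_INR by easy; rewrite !INR_IZR_INZ; simpl; field.

Lemma Phi_pair_expansion a b :
  has_expansion 0 (CDerive (Phi [a; b])) 1 (a + b) /\
  has_expansion 1 (Phi [a; b]) 1 ((a + b) / 2).
Proof.
  assert (NE : [a; b] <> []) by easy.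
  pose proof (Phi_fundamental _ NE) as H. pose proof (fundamental_next_derivative _ _ NE H) as T.
  destruct H as (D & _ & I & L). simpl in D, I, L, T.
  apply differentiable_n_S in D as [D0 D]. apply differentiable_n_S in D as [D1 _].
  assert (E1 : has_expansion 0 (CDerive (Phi [a; b])) 1 (a + b)).
  { rewrite <- L. apply has_expansion_deriv. eapply has_deriv_eq; [apply D1|]. rewrite T. ring. }
  split; [exact E1|].
  pose proof (has_expansion_primitive 0 _ _ _ _ D0 (I 0%nat ltac:(lia)) E1) as E0.
  apply (has_expansion_eq _ _ _ _ _ _ E0); inv_INR_field.
Qed.

Lemma Phi_quadruple_expansion a b c d :
  let t := a + b + c + d in
  has_expansion 2 (CDerive (Phi [a; b; c; d])) (/ 2) (t / 6) /\
  has_expansion 3 (Phi [a; b; c; d]) (/ 6) (t / 24).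
Proof.
  intros t. assert (NE : [a; b; c; d] <> []) by easy.
  pose proof (Phi_fundamental _ NE) as H. pose proof (fundamental_next_derivative _ _ NE H) as T.
  destruct H as (D & _ & I & L). simpl in D, I, L, T. set (F := Phi [a; b; c; d]) in *.
  apply differentiable_n_S in D as [D0 D]. apply differentiable_n_S in D as [D1 D].
  apply differentiable_n_S in D as [D2 D]. apply differentiable_n_S in D as [D3 _].
  assert (E3 : has_expansion 0 (CDerive (CDerive (CDerive F))) 1 t).
  { rewrite <- L. apply has_expansion_deriv. eapply has_deriv_eq; [apply D3|].
    rewrite T. unfold t. ring. }
  pose proof (has_expansion_primitive 0 _ _ _ _ D2 (I 2%nat ltac:(lia)) E3) as E2.
  pose proof (has_expansion_primitive 1 _ _ _ _ D1 (I 1%nat ltac:(lia)) E2) as E1.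
  pose proof (has_expansion_primitive 2 _ _ _ _ D0 (I 0%nat ltac:(lia)) E1) as E0.
  split.
  - apply (has_expansion_eq _ _ _ _ _ _ E1); inv_INR_field.
  - apply (has_expansion_eq _ _ _ _ _ _ E0); inv_INR_field.
Qed.

(** * The function rho *)

(** The symmetry of {a, b} under m |-> a + b - m holds for every pair, so the domain of rho is
    symmetric about 0 for all exponents. *)
Lemma rho_domain_opp l0 l1 l2 l3 x :
  rho_domain l0 l1 l2 l3 x -> rho_domain l0 l1 l2 l3 (- x)%R.
Proof.
  assert (Z : forall a b, Phi [a; b] x <> 0 -> Phi [a; b] (- x)%R <> 0).
  { intros a b H K. apply H. rewrite Phi_pair_reflect. unfold reflect. rewrite K. ring. }
  unfold rho_domain, rho_denominator. intros H.
  apply Cmult_neq_0; apply Z; intros K; apply H; rewrite K; ring.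
Qed.

(** Expressing P, Q, F and the derivatives P', F' at x through their values at -x turns rho(x)
    into - rho(-x); the factors e^(s x), and the terms coming from their derivatives, cancel. *)
Lemma rho_opp l0 l1 l2 l3 x :
  l0 + l1 = l2 + l3 -> rho_domain l0 l1 l2 l3 x ->
  rho l0 l1 l2 l3 (- x)%R = - rho l0 l1 l2 l3 x.
Proof.
  intros S Hx. pose proof (rho_domain_opp _ _ _ _ _ Hx) as Hx'.
  pose proof (Phi_pair_reflect l0 l1) as RP. pose proof (Phi_pair_reflect l2 l3) as RQ.
  pose proof (Phi_quadruple_reflect l0 l1 l2 l3 S) as RF.
  rewrite <- S in RQ. set (s := l0 + l1) in *.
  assert (CD : forall mus, mus <> [] -> Phi mus = reflect (- (1)) s (Phi mus) ->
    CDerive (Phi mus) x = reflect 1 s (shifted_derive s (Phi mus)) x).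
  { intros mus NE R. destruct (Phi_fundamental mus NE) as (D & _).
    apply differentiable_n_S in D as [D _]. rewrite R at 1.
    rewrite (has_deriv_CDerive _ _ _ (has_deriv_reflect _ _ _ D x)). unfold reflect. ring. }
  unfold rho_domain, rho_denominator in Hx'. unfold rho, rho_denominator.
  rewrite (CD [l0; l1] ltac:(easy) RP), (CD [l0; l1; l2; l3] ltac:(easy) RF).
  rewrite (equal_f RP x), (equal_f RQ x), (equal_f RF x).
  unfold reflect, shifted_derive.
  pose proof (cexp_neq0 s x) as EN.
  field. repeat split; try exact EN; intros K; apply Hx'; rewrite K; ring.
Qed.

(** Comparison of the coefficients of x^6 in W(-x) Den(x) + W(x) Den(-x) = 0. *)
Lemma odd_rho_sums_equal l0 l1 l2 l3 :
  odd_on (rho_domain l0 l1 l2 l3) (rho l0 l1 l2 l3) -> l0 + l1 = l2 + l3.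
Proof.
  intros [Sym Odd].
  destruct (Phi_pair_expansion l0 l1) as [EP' EP].
  destruct (Phi_pair_expansion l2 l3) as [_ EQ].
  destruct (Phi_quadruple_expansion l0 l1 l2 l3) as [EF' EF].
  pose proof (has_expansion_mult _ _ _ _ _ _ _ _ EP EQ) as EDen.
  pose proof (has_expansion_plus _ _ _ _ _ _ _ (has_expansion_mult _ _ _ _ _ _ _ _ EF' EP)
    (has_expansion_scal _ (- (1)) _ _ _ (has_expansion_mult _ _ _ _ _ _ _ _ EF EP'))) as EW.
  simpl Nat.add in EDen, EW.
  set (Den := fun x => Phi [l0; l1] x * Phi [l2; l3] x) in *.
  match type of EW with has_expansion _ ?w _ _ => set (W := w) in * end.
  pose proof (has_expansion_plus _ _ _ _ _ _ _
    (has_expansion_mult _ _ _ _ _ _ _ _ (has_expansion_flip _ _ _ _ EW) EDen)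
    (has_expansion_mult _ _ _ _ _ _ _ _ EW (has_expansion_flip _ _ _ _ EDen))) as E.
  apply has_expansion_zero in E as [_ E].
  - replace (RtoC ((-1) ^ 3)%R) with (- (1)) in E
      by (rewrite <- RtoC_opp; f_equal; ring).
    replace (RtoC ((-1) ^ 2)%R) with (RtoC 1) in E by (f_equal; ring).
    (* The coefficient of x^6 is (l0 + l1 - l2 - l3) / 12. *)
    match type of E with ?e = _ =>
      replace (l0 + l1) with (l2 + l3 + 12 * e); [rewrite E; ring|] end.
    field.
  - intros x. cbv beta.
    assert (WE : forall y, W y = CDerive (Phi [l0; l1; l2; l3]) y * Phi [l0; l1] y
      - Phi [l0; l1; l2; l3] y * CDerive (Phi [l0; l1]) y).
    { intros y. unfold W. ring. }
    (* The domain being symmetric, Den vanishes at -x whenever it does at x. *)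
    destruct (Ceq_dec (Den x) 0) as [Z|NZ].
    + destruct (Ceq_dec (Den (- x)%R) 0) as [Z'|NZ'].
      * rewrite Z, Z'. ring.
      * apply Sym in NZ'. rewrite Ropp_involutive in NZ'. now destruct NZ'.
    + pose proof (Sym x NZ) as NZ'. pose proof (Odd x NZ) as O.
      unfold rho in O. rewrite <- !WE in O.
      change (rho_denominator l0 l1 l2 l3) with Den in *.
      change (Den (- x)%R <> 0) in NZ'.
      replace (W (- x)%R) with (W (- x)%R / Den (- x)%R * Den (- x)%R) by (field; exact NZ').
      rewrite O. field. exact NZ.
Qed.

Theorem theorem32 (l0 l1 l2 l3 : C) :
  odd_on (rho_domain l0 l1 l2 l3) (rho l0 l1 l2 l3) <->
  (l0 + l1 = l2 + l3)%C.
Proof.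
  split; [apply odd_rho_sums_equal|]. intros H. split.
  - intros x. apply rho_domain_opp.
  - intros x. now apply rho_opp.
Qed.
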